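(* Let $p$ be a prime and let the cyclic group $C_{p^r}$ of order $p^r$ act by group automorphisms on a finite elementary abelian $p$-group $E$, so that $E$ is a module over the group ring $\mathbb{F}_pC_{p^r}$. Suppose that $E$ contains a non-zero free $\mathbb{F}_pC_{p^r}$-submodule. Then, for every sufficiently large field $\mathbb{F}$ of characteristic $p$ (i.e. for every field $\mathbb{F}$ of characteristic $p$ with $|\mathbb{F}|\geq N$, for some integer $N$ depending only on $p^r$, $E$ and the action), the minimum dimension of a faithful representation over $\mathbb{F}$ of the semidirect product $C_{p^r}\ltimes E$ is $p^r+1$.
   Context: A representation over $\mathbb{F}$ of dimension $d$ is a group homomorphism to $\mathrm{GL}_d(\mathbb{F})$; it is faithful if this homomorphism is injective. *)

(* Defs.v *)
From mathcomp Require Import all_boot all_order all_algebra all_fingroup.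
From mathcomp Require Import all_solvable all_field all_character.

Set Implicit Arguments.
Unset Strict Implicit.
Unset Printing Implicit Defensive.

Import GRing.Theory.
Local Open Scope group_scope.

Section GroupRingModule.

Variables (p : nat) (aT rT : finGroupType).
Variables (C : {group aT}) (E : {group rT}) (to : groupAction C E).

(* Coefficient functions of the elements of F_p[C]; indexing by the subtype   *)
(* [subg C] makes the coefficients of an element unique.                      *)
Definition Fpgring := {ffun subg_of C -> 'F_p}.

(* The action of a = \sum_g a_g g on E, written multiplicatively. Exponents   *)
(* are representatives in nat of elements of 'F_p. This is meant for a prime  *)
(* p and p.-abelem E, where neither the representatives nor the order of the  *)
(* factors matter. As C is commutative in the intended use, the right action  *)
(* to is also a left action.                                                  *)
Definition Fpgring_act (a : Fpgring) (x : rT) : rT :=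
  \prod_(g : subg_of C) to x (val g) ^+ (a g : nat).

Definition Fpgring_submodule (M : {group rT}) : Prop :=
  M \subset E /\ forall (a : Fpgring) (x : rT), x \in M -> Fpgring_act a x \in M.

Definition Fpgring_basis (M : {group rT}) (n : nat) (b : 'I_n -> rT) : Prop :=
  (forall i, b i \in M) /\
  forall x, x \in M ->
    exists! a : {ffun 'I_n -> Fpgring}, x = \prod_(i < n) Fpgring_act (a i) (b i).

(* M is finite and F_p[C] is non-trivial, so every basis of M is finite.      *)
Definition Fpgring_free (M : {group rT}) : Prop :=
  exists (n : nat) (b : 'I_n -> rT), Fpgring_basis M b.

End GroupRingModule.

Definition has_faithful_repr (F : fieldType) (gT : finGroupType)
    (G : {group gT}) (d : nat) : Prop :=
  exists rG : mx_representation F G d, mx_faithful rG.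

Definition min_faithful_dim (F : fieldType) (gT : finGroupType)
    (G : {group gT}) (d : nat) : Prop :=
  has_faithful_repr F G d /\
  forall d' : nat, has_faithful_repr F G d' -> (d <= d')%N.

(* |F| >= N, for a possibly infinite type F.                                  *)
Definition card_at_least (F : eqType) (N : nat) : Prop :=
  exists2 s : seq F, uniq s & (N <= size s)%N.

(* Main.v *)
Require Import Defs.
From mathcomp Require Import all_boot all_order all_algebra all_fingroup.
From mathcomp Require Import all_solvable all_field all_character.

(** Upper bound: once |F| >= |E|, E embeds additively in F by some lambda, and
x |-> (c |-> lambda (x ^ c)) is an equivariant embedding of E in the regular
module F^C; C |x F^C acts faithfully on F^C + F by affine maps.
Lower bound: if b is part of an F_p[C]-basis and c generates C, then the
p^r-th power of b * c^-1 in the semidirect product is the norm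
\prod_(g in C) b ^ g, which is not 1.  So the group has an element of order
p^(r+1), whereas a p-element U of GL_d(F) satisfies (U - 1)^d = 0, whence
U^(p^r) - 1 = (U - 1)^(p^r) = 0 if d <= p^r. *)

Set Implicit Arguments.
Unset Strict Implicit.
Unset Printing Implicit Defensive.

Local Open Scope group_scope.

(** * Orders of [p]-elements in linear groups of characteristic [p] *)

Section Unipotent.

Import GRing.Theory.
Local Open Scope ring_scope.

Lemma exprB1_pchar (R : comNzRingType) (p k : nat) (x : R) :
  p \in [pchar R] -> (x - 1) ^+ (p ^ k)%N = x ^+ (p ^ k)%N - 1.
Proof.
move=> chRp.
have pn : [pchar R].-nat (p ^ k)%N.
  by rewrite pnatX (eq_pnat _ (pcharf_eq chRp)) pnat_id ?(pcharf_prime chRp).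
by rewrite exprDn_pchar // exprNn_pchar // expr1n.
Qed.

(** The minimal polynomial divides [('X - 1) ^+ (p ^ k)], so it is [('X - 1) ^+ j] up to a unit. It
    also divides the characteristic polynomial, of degree [d.+1], whence [j <= d.+1 <= p ^ m]. *)
Lemma pelt_mx_exp (F : fieldType) (p k m d : nat) (A : 'M[F]_d.+1) :
  p \in [pchar F] -> A ^+ (p ^ k)%N = 1 -> (d < p ^ m)%N ->
  A ^+ (p ^ m)%N = 1.
Proof.
move=> chFp Ak1 ltdm.
have chP : p \in [pchar {poly F}] by rewrite (rmorph_pchar polyC).
(* The Frobenius identity needs a commutative ring: it is used in [{poly F}] and carried to [A] by
   evaluation. *)
have horner_exp n : horner_mx A (('X - 1%:P) ^+ (p ^ n)%N) = A ^+ (p ^ n)%N - 1.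
  by rewrite polyC1 exprB1_pchar // rmorphB rmorphXn rmorph1 /= horner_mx_X.
have /mxminpoly_min : horner_mx A (('X - 1%:P) ^+ (p ^ k)%N) = 0.
  by rewrite horner_exp Ak1 subrr.
case/dvdp_exp_XsubCP=> j _ eqj.
have lej : (j <= p ^ m)%N.
  apply: leq_trans ltdm; rewrite -ltnS -(size_exp_XsubC j (1 : F)).
  rewrite -(eqp_size eqj) -(size_char_poly A).
  by apply: dvdp_leq (mxminpoly_dvd_char A); rewrite -size_poly_eq0 size_char_poly.
apply/eqP; rewrite -subr_eq0 -horner_exp; apply/eqP/mxminpoly_minP.
by apply/dvdp_exp_XsubCP; exists j.
Qed.

Lemma faithful_pelt_dim (F : fieldType) (gT : finGroupType) (G : {group gT})
    (p k m d : nat) (rG : mx_representation F G d) (x : gT) :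
  p \in [pchar F] -> mx_faithful rG ->
  x \in G -> (x ^+ (p ^ k) = 1)%g -> (x ^+ (p ^ m) != 1)%g -> (p ^ m < d)%N.
Proof.
move=> chFp fG Gx xk1 xm1; rewrite ltnNge; apply: contra xm1 => led.
suff: (x ^+ (p ^ m))%g \in rker rG by move/(subsetP fG); rewrite inE.
rewrite inE mul1mx groupX //=; apply/eqP.
(* Square matrices form a ring only in size [d.+1]; in size 0 all matrices are equal. *)
case: d rG fG led => [|d] rG fG led; first by rewrite [LHS]flatmx0 [RHS]flatmx0.
rewrite repr_mxX //; apply: (pelt_mx_exp (k := k)) => //.
by rewrite -repr_mxX // xk1 repr_mx1.
Qed.

End Unipotent.

(** * Additive embedding of [E] in a large field *)

Section Embedding.

Import GRing.Theory.
Local Open Scope ring_scope.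

(** Greedy choice: the span of [n] vectors has at most [#|K| ^ n] elements, so a list of
    [#|K| ^ n.+1] distinct vectors leaves it. *)
Lemma exists_free_family (K : finFieldType) (V : lmodType K) (n : nat) :
  card_at_least V (#|K| ^ n) ->
  exists w : 'I_n -> V,
    forall v : 'I_n -> K, \sum_i v i *: w i = 0 -> forall i, v i = 0.
Proof.
elim: n => [|n IHn] [s Us les]; first by exists (fun=> 0) => v _ [].
have K1 := finNzRing_gt1 K.
have les' : (#|K| ^ n < size s)%N.
  by apply: leq_trans les; rewrite ltn_exp2l.
have [|w wfree] := IHn; first by exists s; last exact: ltnW.
pose im := codom (fun v : {ffun 'I_n -> K} => \sum_i v i *: w i).
have [x _ x_im] : exists2 x, x \in s & x \notin im.
  apply/hasP; apply: contraLR les'; rewrite -all_predC -leqNgt => /allP sim.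
  have /(uniq_leq_size Us) : {subset s <= im}.
    by move=> x /sim /=; rewrite negbK.
  by rewrite size_codom card_ffun card_ord.
exists (fun i => oapp w x (unlift ord0 i)) => v.
rewrite big_ord_recl unlift_none /=.
under eq_bigr do rewrite liftK /=.
have [v0|nz_v0] := eqVneq (v ord0) 0.
  rewrite v0 scale0r add0r => /wfree v'0 i.
  by case: (unliftP ord0 i) => [j|] ->.
move=> sum0; case/negP: x_im; apply/codomP.
(* Solving the relation for [x], whose coefficient is non-zero, would put [x] in the span of [w]. *)
exists [ffun i => - (v ord0)^-1 * v (lift ord0 i)].
under eq_bigr do rewrite ffunE -scalerA.
rewrite -scaler_sumr -(addKr (v ord0 *: x) (\sum_i _)) sum0 addr0.
by rewrite scalerN scaleNr opprK scalerA mulVf // scale1r.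
Qed.

(** The ['F_p]-coordinates on [E] become coefficients of a family in [F] that is free over the prime
    field. *)
Lemma abelem_additive_embedding (p : nat) (rT : finGroupType) (E : {group rT})
    (F : fieldType) :
  p.-abelem E -> E :!=: 1%g -> p \in [pchar F] -> card_at_least F #|E| ->
  exists lam : rT -> F,
    {in E &, {morph lam : x y / (x * y)%g >-> x + y}}
    /\ {in E, forall x, lam x = 0 -> x = 1%g}.
Proof.
move=> abE ntE chFp bigF.
have [|w wfree] := @exists_free_family 'F_p (pPrimeCharType chFp) ('dim E).
  case: bigF => s Us les; exists s => //.
  by rewrite -(card_abelem_rV abE ntE) card_mx mul1n in les.
pose f := abelem_rV abE ntE.
exists (fun x => \sum_i f x 0 i *: (w i : pPrimeCharType chFp)).
split=> [x y Ex Ey|x Ex].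
  rewrite /f abelem_rV_M // -big_split /=.
  by apply: eq_bigr => i _; rewrite mxE scalerDl.
move/wfree=> fx0; apply: (@abelem_rV_inj p _ E abE ntE) => //.
by rewrite abelem_rV_1; apply/rowP=> i; rewrite [LHS]fx0 mxE.
Qed.

End Embedding.

(** * The affine representation of dimension [#|C| + 1] *)

Section AffineRepr.

Import GRing.Theory.
Local Open Scope ring_scope.

Variables (aT rT : finGroupType) (C : {group aT}) (E : {group rT}).
Variables (to : groupAction C E) (F : fieldType) (lam : rT -> F).
Hypothesis lamM : {in E &, {morph lam : x y / (x * y)%g >-> x + y}}.
Hypothesis lam_inj : {in E, forall x, lam x = 0 -> x = 1%g}.

Local Notation ev := (@enum_val aT (mem C)).

Definition translation_mx (a : aT) : 'M[F]_#|C| :=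
  \matrix_(j, i) (ev j == (a * ev i)%g)%:R.

Definition orbit_row (x : rT) : 'rV[F]_#|C| := \row_i lam (to x (ev i)).

(** On row vectors [(v, 1)] this is the affine map with linear part [translation_mx u.1] and
    translation vector [orbit_row u.2]. *)
Definition affine_mx (u : sdprod_by to) : 'M[F]_(#|C| + 1) :=
  block_mx (translation_mx u.1) 0 (orbit_row u.2) 1.

Lemma mul_translation_mx m (A : 'M_(m, #|C|)) (a : aT) i j k :
  a \in C -> ev k = (a * ev j)%g -> (A *m translation_mx a) i j = A i k.
Proof.
move=> Ca evk; rewrite mxE (bigD1 k) //= mxE -evk eqxx mulr1 big1 ?addr0 //.
move=> l nekl; rewrite mxE -evk (inj_eq enum_val_inj) (negPf nekl).
by rewrite mulr0.
Qed.

Lemma translate_enum_val (a : aT) (j : 'I_#|C|) :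
  a \in C -> exists k, ev k = (a * ev j)%g.
Proof.
move=> Ca; have Caj : (a * ev j)%g \in C by rewrite groupM // enum_valP.
by exists (enum_rank_in Caj (a * ev j)%g); rewrite enum_rankK_in.
Qed.

Lemma affine_mx_repr : mx_repr [set: sdprod_by to]%G affine_mx.
Proof.
have lam1 : lam 1%g = 0.
  by apply: (addrI (lam 1%g)); rewrite -lamM // mulg1 addr0.
split=> [|u v _ _].
  rewrite /affine_mx scalar_mx_block; congr block_mx.
    apply/matrixP=> i j; rewrite !mxE /= mul1g.
    by rewrite (inj_eq enum_val_inj).
  by apply/rowP=> i; rewrite !mxE /= gact1 // enum_valP.
case: u v => [[a x] /= Cax] [[b y] /= Cby].
have [[Ca Ex] [Cb Ey]] := (setXP Cax, setXP Cby).
rewrite /affine_mx mulmx_block /= !mulmx0 !mul0mx !addr0 add0r !mulmx1 mul1mx.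
congr block_mx.
  apply/matrixP=> i j; have [k evk] := translate_enum_val j Cb.
  by rewrite (mul_translation_mx _ _ Cb evk) !mxE evk mulgA.
apply/rowP=> j; have [k evk] := translate_enum_val j Cb.
have Cj := enum_valP j.
rewrite [RHS]mxE (mul_translation_mx _ _ Cb evk) !mxE evk gactM ?gact_stable //.
by rewrite lamM ?gact_stable // (actMin to).
Qed.

Definition affine_repr := MxRepresentation affine_mx_repr.

Lemma affine_repr_faithful : mx_faithful affine_repr.
Proof.
apply/subsetP=> u; rewrite !inE mul1mx => /andP[_ /eqP].
rewrite /= /affine_mx scalar_mx_block => /eq_block_mx[tr1 _ row0 _].
case: u tr1 row0 => [[a x] /= Cax]; have [Ca Ex] := setXP Cax.
(* At the index of [1], the diagonal entry of the translation block tests [a = 1], and the entry of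
   the orbit row is [lam x]. *)
pose i0 := enum_rank_in (group1 C) 1%g.
have ev1 : ev i0 = 1%g by rewrite enum_rankK_in.
move=> /matrixP/(_ i0 i0) + /rowP/(_ i0).
rewrite !mxE eqxx ev1 mulg1 act1 => /eqP.
rewrite -val_eqE /=; case: (1%g =P a) => [<- _ /(lam_inj Ex)-> //|_].
by rewrite eq_sym oner_eq0.
Qed.

End AffineRepr.

(** * Norms and powers in the semidirect product *)

Section Norm.

Lemma expg_mul_conjg (gT : finGroupType) (x y : gT) (n : nat) :
  (y * x) ^+ n = (\prod_(i < n) y ^ (x ^- i)) * x ^+ n.
Proof.
elim: n => [|n IHn]; first by rewrite big_ord0 mulg1.
by rewrite big_ord_recr expgSr IHn /= conjgE invgK expgSr !mulgA mulgKV.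
Qed.

Variables (p : nat) (aT rT : finGroupType) (C : {group aT}) (E : {group rT}).
Variable to : groupAction C E.

(** Both sides are the norm of [b]: the constant function 1 is the sum of all elements of [C], and
    [i |-> c ^+ i] enumerates [C]. *)
Lemma prod_cycle_Fpgring_act (c : aT) (b : rT) :
  p.-abelem E -> C :=: <[c]> -> b \in E ->
  \prod_(i < #|C|) to b (c ^+ i) =
    Fpgring_act to ([ffun=> 1%R] : Fpgring p C) b.
Proof.
move=> abE defC Eb.
have Cc i : c ^+ i \in C by rewrite defC mem_cycle.
(* The coordinates [abelem_rV] exist only for non-trivial [E]. *)
have [E1|ntE] := eqVneq (E : {set _}) 1.
  have sE1 x : x \in E -> x = 1 by rewrite E1 => /set1P.
  have toE a : a \in C -> to b a = 1.
    by move=> Ca; apply: sE1; rewrite gact_stable.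
  rewrite /Fpgring_act !big1 // => [g _|i _].
    by rewrite toE ?expg1n ?subgP.
  by rewrite toE.
have Eto a : a \in C -> to b a \in E by move=> Ca; rewrite gact_stable.
rewrite /Fpgring_act.
have F1 : (1%R : 'F_p) = 1%N :> nat by [].
under [RHS]eq_bigr => g _ do rewrite ffunE F1 expg1.
apply: (@abelem_rV_inj p _ E abE ntE).
- by apply: group_prod => i _; apply: Eto.
- by apply: group_prod => i _; apply/Eto/subgP.
rewrite !morph_prod => [||i _]; try by move=> *; rewrite Eto ?subgP.
pose h (i : 'I_#|C|) := subg C (c ^+ i).
have hK i : val (h i) = c ^+ i by rewrite /h subgK.
have h_bij : bijective h.
  apply: inj_card_bij; last by rewrite card_ord card_sub.
  move=> i j /(congr1 val); rewrite !hK => /eqP.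
  rewrite eq_expg_mod_order /order -defC !modn_small // => /eqP.
  exact: val_inj.
pose f g := abelem_rV abE ntE (to b (val (g : subg_of C))).
(* The group law of 'rV(E) is its addition, whose big sums can be reindexed. *)
transitivity (\sum_g f g)%R => [|//].
rewrite (reindex h) /=; last exact: onW_bij.
by under [RHS]eq_bigr do rewrite /f hK.
Qed.

(** Taking [c^-1] makes the conjugates that are collected on the left the images of [b] under
    non-negative powers of [c]. *)
Lemma sdprod_expg (c : aT) (b : rT) (n : nat) :
  c \in C -> b \in E ->
  (sdpair1 to b * sdpair2 to c^-1) ^+ n =
    sdpair1 to (\prod_(i < n) to b (c ^+ i)) * sdpair2 to (c ^- n).
Proof.
move=> Cc Eb.
rewrite expg_mul_conjg -morphX ?groupV // expVgn.
rewrite morph_prod => [|i _]; last by rewrite gact_stable ?groupX.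
congr (_ * _); apply: eq_bigr => i _.
by rewrite /= sdpair_act ?groupX // -morphX ?groupV // expVgn morphV ?groupX // invgK.
Qed.

Lemma Fpgring_act0 (x : rT) : Fpgring_act to ([ffun=> 0%R] : Fpgring p C) x = 1.
Proof. by rewrite /Fpgring_act big1 // => g _; rewrite ffunE. Qed.

(** Otherwise [1] would have two coordinate families: zero, and [a] in place [i]. *)
Lemma Fpgring_basis_act_neq1 (M : {group rT}) (n : nat) (b : 'I_n -> rT)
    (i : 'I_n) (a : Fpgring p C) :
  Fpgring_basis p to M b -> a != [ffun=> 0%R] -> Fpgring_act to a (b i) != 1.
Proof.
case=> _ /(_ _ (group1 M)) [a0 [_ a0P]]; apply: contra => /eqP act1.
pose e (a' : Fpgring p C) : {ffun 'I_n -> Fpgring p C} :=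
  [ffun j => if j == i then a' else [ffun=> 0%R]].
have eP a' : Fpgring_act to a' (b i) = 1 -> a0 = e a'.
  move=> a'1; apply: a0P; rewrite big1 // => j _; rewrite ffunE.
  by case: eqP => [->|_] //; apply: Fpgring_act0.
have := eP _ act1; rewrite (eP _ (Fpgring_act0 _)) => /ffunP/(_ i).
by rewrite !ffunE eqxx => ->.
Qed.

End Norm.

Theorem corollary2p4 (p r : nat) (aT rT : finGroupType)
    (C : {group aT}) (E : {group rT}) (to : groupAction C E) :
  prime p ->
  cyclic C -> #|C| = (p ^ r)%N ->
  p.-abelem E ->
  (exists M : {group rT},
     [/\ Fpgring_submodule p to M, M :!=: 1 & Fpgring_free p to M]) ->
  exists N : nat, forall F : fieldType,
    p \in [pchar F]%R -> card_at_least F N ->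
    min_faithful_dim F [set: sdprod_by to]%G (p ^ r + 1)%N.
Proof.
move=> p_pr cycC oC abE [M [[sME _] ntM [n [b bP]]]].
have ntE : E :!=: 1.
  by apply: contraNneq ntM => E1; rewrite -subG1 -E1.
exists #|E| => F chFp bigF; split.
  have [lam [lamM lam_inj]] := abelem_additive_embedding abE ntE chFp bigF.
  rewrite -oC; exists (affine_repr to lamM).
  exact: affine_repr_faithful.
have [bM b_gen] := bP.
(* An empty basis would generate only the empty product [1], but [M] is non-trivial. *)
have i0 : 'I_n.
  case: n b {bP} bM b_gen => [|n] b _ b_gen; last exact: ord0.
  case/negP: ntM; rewrite -subG1; apply/subsetP=> x /b_gen [a [-> _]].
  by rewrite big_ord0.
have Eb := subsetP sME _ (bM i0).
have [c defC] := cyclicP cycC.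
have Cc : c \in C by rewrite defC cycle_id.
have c1 : c ^+ (p ^ r) = 1 by rewrite -oC expg_cardG.
pose x := sdpair1 to (b i0) * sdpair2 to c^-1.
have xpr : x ^+ (p ^ r) =
    sdpair1 to (Fpgring_act to ([ffun=> 1%R] : Fpgring p C) (b i0)).
  rewrite sdprod_expg // c1 invg1 morph1 mulg1 -oC.
  by rewrite (prod_cycle_Fpgring_act to abE defC).
have EN : Fpgring_act to ([ffun=> 1%R] : Fpgring p C) (b i0) \in E.
  by apply: group_prod => g _; rewrite groupX // gact_stable ?subgP.
have [_ Ep] := abelemP p_pr abE.
move=> d [rG fG]; rewrite addn1.
(* The [p ^ r]-th power of [x] is the norm of [b i0], which lies in [E] and so is killed by [p]:
   hence the exponent [r.+1]. *)
apply: (faithful_pelt_dim (k := r.+1) (x := x) chFp fG); rewrite ?inE //.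
  rewrite expnSr expgM xpr -morphX // Ep //.
  by rewrite morph1.
rewrite xpr morph_injm_eq1 ?injm_sdpair1 //.
apply: (Fpgring_basis_act_neq1 _ bP).
apply/eqP=> /ffunP/(_ (subg C 1)); rewrite !ffunE => /eqP.
by rewrite GRing.oner_eq0.
Qed.
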